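(* Let $\mathcal V=\{1,\dots,n\}$, let $X\subset\mathbb R^m$ be a nonempty closed convex set, and let $f_i:\mathbb R^m\to\mathbb R$ ($i\in\mathcal V$) be convex on an open convex set $U_i\supset X$. Suppose there is $L>0$ with $|d|\le L$ for all $d\in\partial f_i(x)$, $x\in X$, $i\in\mathcal V$. Let the stepsizes $\alpha_k>0$ satisfy $\sum_{k=0}^\infty\alpha_k=\infty$ and $\sum_{k=0}^\infty\alpha_k^2<\infty$. Let $A_1,\dots,A_p\in\mathbb R^{n\times n}$ be row stochastic matrices whose associated graphs $\mathcal G_{A_1},\dots,\mathcal G_{A_p}$ are strongly connected, and suppose that there is $0<\eta<1$ such that every positive entry and every diagonal entry of each $A_l$ is at least $\eta$. Let $\mu(A_l)=[\mu_1(A_l),\dots,\mu_n(A_l)]'$ be the Perron vector of $A_l$ and $$X^*_{\mu(A_l)}=\Big\{z\in X : \sum_{i\in\mathcal V}\mu_i(A_l)f_i(z)=\min_{x\in X}\sum_{i\in\mathcal V}\mu_i(A_l)f_i(x)\Big\}.$$ If $\bigcap_{l=1}^p X^*_{\mu(A_l)}=\emptyset$, then there exists a sequence $\{A(k)\}_{k\in\mathbb N}$ with $A(k)\in\{A_1,\dots,A_p\}$ for all $k\in\mathbb N$ (equivalently, a graph sequence $\mathcal G(k)\in\{\mathcal G_{A_1},\dots,\mathcal G_{A_p}\}$) such that the distributed projected subgradient algorithm with weight matrices $A(k)=[a_{ij}(k)]$ is not convergent.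
   Context: $\mathbb N$ is the set of nonnegative integers, $|\cdot|$ is the Euclidean norm, and $x'$ denotes transpose. For $x\in U_i$, $\partial f_i(x)$ is the set of $g\in\mathbb R^m$ such that $f_i(y)-f_i(x)\ge (y-x)'g$ for all $y\in U_i$. $P_X(x)$ is the unique point of $X$ nearest to $x$ in Euclidean norm. The graph associated with a nonnegative matrix $A=[a_{ij}]$ has node set $\mathcal V$ and a directed edge $(j,i)$ if and only if $a_{ij}>0$; it is strongly connected if there is a directed path from every node to every other node. If $A$ is row stochastic with strongly connected graph, its Perron vector $\mu(A)$ is the unique vector with positive entries summing to $1$ such that $\mu(A)'A=\mu(A)'$. Distributed projected subgradient algorithm: given row stochastic weight matrices $A(k)=[a_{ij}(k)]$, each agent $i\in\mathcal V$ starts from $x_i(0)\in\mathbb R^m$ and, for $k\in\mathbb N$, $$v_i(k)=\sum_{j\in\mathcal V}a_{ij}(k)x_j(k),\qquad x_i(k+1)=P_X\big(v_i(k)-\alpha_k d_i(k)\big),\qquad d_i(k)\in\partial f_i(v_i(k)).$$ For a given sequence of weight matrices, the algorithm is called convergent if for every initial condition and every sequences generated by the recursion there is a point $\bar x$ with $\lim_{k\to\infty}|x_i(k)-\bar x|=0$ for all $i\in\mathcal V$; otherwise it is not convergent. *)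

(* Defs.v *)
From mathcomp Require Export all_boot all_order all_algebra.
From mathcomp Require Export all_classical all_reals all_analysis.
Export Order.TTheory GRing.Theory Num.Theory.
Export numFieldNormedType.Exports.

Set Implicit Arguments.
Unset Strict Implicit.
Unset Printing Implicit Defensive.

Local Open Scope classical_set_scope.
Local Open Scope ring_scope.

Definition dotp (R : realType) (m : nat) (u v : 'rV[R]_m) : R :=
  \sum_(i < m) u ord0 i * v ord0 i.

(* The library norm of 'rV[R]_m is the sup norm, hence this definition; both
   norms induce the topology that [open] and [closed] refer to. *)
Definition enorm (R : realType) (m : nat) (u : 'rV[R]_m) : R :=
  Num.sqrt (dotp u u).

(* This is the unique nearest point when X is nonempty, closed and convex, and
   a default value when there is no nearest point. *)
Definition proj (R : realType) (m : nat) (X : set 'rV[R]_m) (x : 'rV[R]_m) :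
    'rV[R]_m :=
  get [set y | X y /\ forall z, X z -> enorm (x - y) <= enorm (x - z)].

(* Subgradients at x of a function considered on U only; empty for x outside
   U. *)
Definition subdiff (R : realType) (m : nat) (U : set 'rV[R]_m)
    (f : 'rV[R]_m -> R) (x : 'rV[R]_m) : set 'rV[R]_m :=
  [set g | U x /\ forall y, U y -> dotp (y - x) g <= f y - f x].

Definition row_stochastic (R : realType) (n : nat) (A : 'M[R]_n) : Prop :=
  (forall i j, 0 <= A i j) /\ (forall i, \sum_(j < n) A i j = 1).

(* [graph_of A j i] is the edge from j to i. *)
Definition graph_of (R : realType) (n : nat) (A : 'M[R]_n) : rel 'I_n :=
  fun j i => 0 < A i j.

Definition strongly_connected (n : nat) (e : rel 'I_n) : Prop :=
  forall i j : 'I_n, connect e i j.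

(* The unique such vector when A is row stochastic with a strongly connected
   graph on a nonempty node set. *)
Definition perron (R : realType) (n : nat) (A : 'M[R]_n) : 'rV[R]_n :=
  get [set mu : 'rV[R]_n |
    [/\ forall i, 0 < mu ord0 i,
        \sum_(i < n) mu ord0 i = 1 &
        mu *m A = mu]].

Definition weighted_argmin (R : realType) (n m : nat) (X : set 'rV[R]_m)
    (f : 'I_n -> 'rV[R]_m -> R) (mu : 'rV[R]_n) : set 'rV[R]_m :=
  [set z | X z /\ forall x, X x ->
    \sum_(i < n) mu ord0 i * f i z <= \sum_(i < n) mu ord0 i * f i x].

(* [x k i] is the state of agent i at time k; the initial states are
   unconstrained, except that every v_i(k) must admit a subgradient. *)
Definition generated (R : realType) (n m : nat) (X : set 'rV[R]_m)
    (U : 'I_n -> set 'rV[R]_m) (f : 'I_n -> 'rV[R]_m -> R) (alpha : nat -> R)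
    (A : nat -> 'M[R]_n) (x : nat -> 'I_n -> 'rV[R]_m) : Prop :=
  exists d : nat -> 'I_n -> 'rV[R]_m,
  forall (k : nat) (i : 'I_n),
    let v := \sum_(j < n) A k i j *: x k j in
    subdiff (U i) (f i) v (d k i) /\
    x k.+1 i = proj X (v - alpha k *: d k i).

Definition convergent (R : realType) (n m : nat) (X : set 'rV[R]_m)
    (U : 'I_n -> set 'rV[R]_m) (f : 'I_n -> 'rV[R]_m -> R) (alpha : nat -> R)
    (A : nat -> 'M[R]_n) : Prop :=
  forall x : nat -> 'I_n -> 'rV[R]_m, generated X U f alpha A x ->
  exists xbar : 'rV[R]_m, forall i : 'I_n,
    (fun k => enorm (x k i - xbar)) @ \oo --> (0 : R).

(* Main.v *)
Require Import Defs.
From mathcomp Require Import ring lra.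

(* Under a constant weight matrix with Perron vector mu, the mu-weighted squared
   distance from the agents to any z in X decreases, up to O(alpha_k^2), by
   2 alpha_k times the gap of the mu-weighted objective between the agents and
   z.  As the stepsizes are not summable but their squares are, a consensus
   limit must minimize this objective over X.
   Suppose that every weight sequence gave convergence.  Run A_1 until all
   agents are within 1 of a point of X*_mu(A_1), then A_2 until they are within
   1/2 of X*_mu(A_2), and so on cyclically.  The limit of this run is
   arbitrarily close to each X*_mu(A_l), hence in all of them by lower
   semicontinuity of the f_i, against the empty intersection. *)

Set Implicit Arguments.
Unset Strict Implicit.
Unset Printing Implicit Defensive.

Local Open Scope classical_set_scope.
Local Open Scope ring_scope.

(** * Euclidean geometry, convex combinations and the projection *)

Section Euclidean.
Context {R : realType} {m : nat}.
Implicit Types (u v w x y z : 'rV[R]_m) (X : set 'rV[R]_m).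

Lemma dotpC u v : dotp u v = dotp v u.
Proof. by apply: eq_bigr => i _; rewrite mulrC. Qed.

Lemma dotpDl u v w : dotp (u + v) w = dotp u w + dotp v w.
Proof.
by rewrite /dotp -big_split; apply: eq_bigr => i _; rewrite mxE mulrDl.
Qed.

Lemma dotpZl c u v : dotp (c *: u) v = c * dotp u v.
Proof.
by rewrite /dotp mulr_sumr; apply: eq_bigr => i _; rewrite mxE mulrA.
Qed.

Lemma dotpDr u v w : dotp u (v + w) = dotp u v + dotp u w.
Proof. by rewrite !(dotpC u) dotpDl. Qed.

Lemma dotpZr c u v : dotp u (c *: v) = c * dotp u v.
Proof. by rewrite !(dotpC u) dotpZl. Qed.

Lemma dotpNl u v : dotp (- u) v = - dotp u v.
Proof. by rewrite -scaleN1r dotpZl mulN1r. Qed.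

Lemma dotpNr u v : dotp u (- v) = - dotp u v.
Proof. by rewrite !(dotpC u) dotpNl. Qed.

Lemma dotpBB u v : dotp (u - v) (u - v) = dotp u u - 2 * dotp u v + dotp v v.
Proof. by rewrite dotpDl !dotpDr !dotpNl !dotpNr (dotpC v u); ring. Qed.

Lemma dotp_suml (I : finType) (u : I -> 'rV[R]_m) v :
  dotp (\sum_i u i) v = \sum_i dotp (u i) v.
Proof.
rewrite /dotp exchange_big; apply: eq_bigr => i _.
by rewrite summxE mulr_suml.
Qed.

Lemma dotp_ge0 u : 0 <= dotp u u.
Proof. by apply: sumr_ge0 => i _; rewrite -expr2 sqr_ge0. Qed.

Lemma enorm_ge0 u : 0 <= enorm u.
Proof. exact: sqrtr_ge0. Qed.

Lemma sqr_enorm u : enorm u ^+ 2 = dotp u u.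
Proof. by rewrite sqr_sqrtr// dotp_ge0. Qed.

Lemma le_enorm u v : (enorm u <= enorm v) = (dotp u u <= dotp v v).
Proof. by rewrite ler_psqrt// ?nnegrE dotp_ge0. Qed.

Lemma enormN u : enorm (- u) = enorm u.
Proof. by rewrite /enorm dotpNl dotpNr opprK. Qed.

Lemma enormBC u v : enorm (u - v) = enorm (v - u).
Proof. by rewrite -enormN opprB. Qed.

(* Expand |b u - a v|^2 >= 0 with a = |u| and b = |v|. *)
Lemma cauchy_schwarz u v : dotp u v <= enorm u * enorm v.
Proof.
have a0 := enorm_ge0 u; have b0 := enorm_ge0 v.
have := dotp_ge0 (enorm v *: u - enorm u *: v).
rewrite dotpBB !(dotpZl, dotpZr).
rewrite -!sqr_enorm; move: a0 b0.
set a := enorm u; set b := enorm v; move=> a0 b0 h.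
(* When a b = 0 the expansion only says 0 >= 0; then one of the two vectors vanishes. *)
have [ab0|ab0] := eqVneq (a * b) 0; last first.
  have abp : 0 < a * b by rewrite lt_neqAle eq_sym ab0 mulr_ge0.
  rewrite -(ler_pM2l abp); nra.
have {}h : enorm u = 0 \/ enorm v = 0.
  by move/eqP: ab0; rewrite mulf_eq0 => /orP[]/eqP; [left|right].
have z0 w : enorm w = 0 -> w = 0.
  move=> w0; have := sqr_enorm w; rewrite w0 expr0n/= => /esym/eqP.
  rewrite psumr_eq0; last by move=> i _; rewrite -expr2 sqr_ge0.
  move=> /allP z; apply/rowP => i; have := z i (mem_index_enum _).
  by rewrite /= mulf_eq0 orbb mxE => /eqP.
rewrite ab0; case: h => /z0 ->; rewrite /dotp big1// => i _;
  by rewrite mxE ?mul0r ?mulr0.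
Qed.

Lemma enormD u v : enorm (u + v) <= enorm u + enorm v.
Proof.
rewrite -(@ler_pXn2r _ 2)// ?nnegrE ?addr_ge0 ?enorm_ge0//.
rewrite sqr_enorm !(dotpDl, dotpDr) (dotpC v u) -!sqr_enorm.
have := cauchy_schwarz u v; nra.
Qed.

Lemma enormZ c u : enorm (c *: u) = `|c| * enorm u.
Proof.
by rewrite /enorm dotpZl dotpZr mulrA -expr2 sqrtrM ?sqr_ge0// sqrtr_sqr.
Qed.

Lemma enorm_sum (I : finType) (u : I -> 'rV[R]_m) :
  enorm (\sum_i u i) <= \sum_i enorm (u i).
Proof.
elim/big_ind2 : _ => [|a b c d h1 h2|//]; last first.
  by rewrite (le_trans (enormD _ _))// lerD.
by rewrite /enorm /dotp big1 ?sqrtr0// => i _; rewrite mxE mul0r.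
Qed.

(** Passes from Euclidean bounds to the sup norm, in which boundedness and neighbourhoods are
    expressed. *)
Lemma norm_le_enorm u : `|u| <= enorm u.
Proof.
rewrite [leLHS]/Num.Def.normr/= mx_normrE; apply/bigmax_leP; split.
  exact: enorm_ge0.
case=> i j _ /=; rewrite ord1 -sqrtr_sqr ler_psqrt ?nnegrE ?sqr_ge0 ?dotp_ge0//.
rewrite /dotp (bigD1 j)//= -expr2 lerDl sumr_ge0// => k _.
by rewrite -expr2 sqr_ge0.
Qed.

Lemma convex_comb2 X x y (t : R) : convex_set X -> X x -> X y ->
  0 <= t -> t <= 1 -> X (t *: x + (1 - t) *: y).
Proof.
move=> cX Xx Xy t0 t1.
by have := cX x y (Itv01 t0 t1); rewrite !inE => /(_ Xx Xy).
Qed.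

Lemma convex_comb (I : finType) X (a : I -> R) (x : I -> 'rV[R]_m) :
  convex_set X -> (forall i, X (x i)) -> (forall i, 0 <= a i) ->
  \sum_i a i = 1 -> X (\sum_i a i *: x i).
Proof.
move=> cX Xx a0.
(* Partial weights do not sum to 1, so the induction on the list is run on normalized
   combinations. *)
suff main (s : seq I) : 0 < \sum_(i <- s) a i ->
    X ((\sum_(i <- s) a i)^-1 *: \sum_(i <- s) a i *: x i).
  by move=> a1; have := main (index_enum I); rewrite a1 invr1 scale1r; apply.
elim: s => [|i s ih]; first by rewrite big_nil ltxx.
rewrite !big_cons => S0.
have S'0 : 0 <= \sum_(j <- s) a j by exact: sumr_ge0.
set S := \sum_(j <- s) a j in ih S0 S'0 *.
have [Z|Sn0] := eqVneq S 0.
  have -> : \sum_(j <- s) a j *: x j = 0.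
    rewrite big_seq big1// => j js.
    suff -> : a j = 0 by rewrite scale0r.
    apply/eqP; move/eqP: Z; rewrite psumr_eq0// => /allP/(_ _ js).
    by [].
  rewrite Z !addr0 scalerA mulVf ?scale1r//.
  by move: S0; rewrite Z addr0 => /lt0r_neq0.
have Sp : 0 < S by rewrite lt_neqAle eq_sym Sn0.
have -> : (a i + S)^-1 *: (a i *: x i + \sum_(j <- s) a j *: x j) =
  (a i / (a i + S)) *: x i +
  (1 - a i / (a i + S)) *: (S^-1 *: \sum_(j <- s) a j *: x j).
  rewrite scalerDr !scalerA; congr (_ *: _ + _ *: _); first by rewrite mulrC.
  by field; rewrite Sn0 lt0r_neq0.
apply: convex_comb2 => //; first exact: ih.
  by rewrite divr_ge0// ltW.
by rewrite ler_pdivrMr// mul1r lerDl ltW.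
Qed.

(* Jensen for |.|^2, from expanding \sum_i a_i |u_i - mean|^2 >= 0. *)
Lemma dotp_jensen (I : finType) (a : I -> R) (u : I -> 'rV[R]_m) :
  (forall i, 0 <= a i) -> \sum_i a i = 1 ->
  dotp (\sum_i a i *: u i) (\sum_i a i *: u i) <= \sum_i a i * dotp (u i) (u i).
Proof.
move=> a0 a1; set w := \sum_i a i *: u i.
have : 0 <= \sum_i a i * dotp (u i - w) (u i - w).
  by apply: sumr_ge0 => i _; rewrite mulr_ge0// dotp_ge0.
have -> : \sum_i a i * dotp (u i - w) (u i - w) =
  \sum_i (a i * dotp (u i) (u i) + (a i * dotp w w - 2 * dotp (a i *: u i) w)).
  by apply: eq_bigr => i _; rewrite dotpBB dotpZl; ring.
rewrite big_split/= sumrB -mulr_suml a1 -mulr_sumr -dotp_suml -/w.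
by move: (dotp w w) (\sum_i _) => {w} p q; lra.
Qed.

Lemma continuous_dotp_sub z : continuous (fun y => dotp (z - y) (z - y)).
Proof.
rewrite /dotp; apply: continuous_big => [|i _]; first exact: add_continuous.
have cz : continuous (fun w : 'rV[R]_m => (z - w) ord0 i).
  rewrite (_ : (fun _ => _) = (fun w => z ord0 i - w ord0 i)); last first.
    by apply/funext => w; rewrite !mxE.
  by move=> y; exact: cvgB (cvg_cst _) (@coord_continuous _ _ _ ord0 i y).
by move=> y; exact: cvgM (cz y) (cz y).
Qed.

(** The part of X no farther from x than some x0 in X is compact, so the squared distance attains
    its minimum there. *)
Lemma exists_nearest X x : X !=set0 -> closed X ->
  exists y, X y /\ forall z, X z -> enorm (x - y) <= enorm (x - z).
Proof.
move=> [x0 Xx0] Xc.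
pose f y := dotp (x - y) (x - y).
pose B := X `&` [set y | f y <= f x0].
have Bc : compact B.
  apply: bounded_closed_compact.
    apply: filterS (nbhs_pinfty_ge (num_real (enorm x + enorm (x - x0)))).
    move=> M hM y [_ /= fy]; apply: le_trans (norm_le_enorm y) _.
    apply: le_trans hM; rewrite -[y](subrKC x) (le_trans (enormD _ _))//.
    by rewrite lerD// [enorm (y - x)]enormBC le_enorm.
  apply: closedI => //; apply: (@preimage_closed _ _ f [set r | r <= f x0]).
    by move=> y _; exact: continuous_dotp_sub.
  exact: closed_le.
have [||y By ymin] := @EVT_min_rV R m f B _ Bc.
- by exists x0; split => //=.
- by apply: continuous_subspaceT; exact: continuous_dotp_sub.
exists y; move: By; rewrite inE => -[Xy fy]; split=> // z Xz.
rewrite le_enorm; have [fz|/ltW fz] := leP (f z) (f x0).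
  by apply: ymin; rewrite inE.
exact: le_trans fy fz.
Qed.

Lemma projP X x : X !=set0 -> closed X ->
  X (proj X x) /\ forall z, X z -> enorm (x - proj X x) <= enorm (x - z).
Proof. by move=> X0 Xc; exact: getPex (exists_nearest x X0 Xc). Qed.

(* Comparing x with the points of the segment from proj X x to z gives the
   obtuse angle property (x - proj X x)'(z - proj X x) <= 0. *)
Lemma proj_le X x z : X !=set0 -> closed X -> convex_set X -> X z ->
  dotp (proj X x - z) (proj X x - z) <= dotp (x - z) (x - z).
Proof.
move=> X0 Xc cX Xz; have [] := projP x X0 Xc; set y := proj X x => Xy ymin.
pose a := dotp (x - y) (z - y); pose b := dotp (z - y) (z - y).
have step t : 0 <= t -> t <= 1 -> t * (2 * a) <= t ^+ 2 * b.
  move=> t0 t1; have := ymin _ (convex_comb2 cX Xz Xy t0 t1).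
  rewrite le_enorm.
  have -> : x - (t *: z + (1 - t) *: y) = (x - y) - t *: (z - y).
    by apply/rowP => i; rewrite !mxE; ring.
  rewrite [leRHS]dotpBB dotpZr dotpZl dotpZr -/a -/b; nra.
have a0 : a <= 0.
  rewrite leNgt; apply/negP => ap.
  have b0 : 0 <= b := dotp_ge0 _.
  (* The choice t = a / (a + b) is at most 1 and gives t b <= a, whereas [step] divided by t says 2
     a <= t b. *)
  have tp : 0 < a / (a + b) by rewrite divr_gt0// ltr_wpDr.
  have tab : a / (a + b) * (a + b) = a by rewrite divfK// gt_eqF// ltr_wpDr.
  have := step _ (ltW tp); move: tp tab; set t := _ / _ => tp tab.
  have t1 : t <= 1 by rewrite ler_pdivrMr ?ltr_wpDr// mul1r lerDl.
  move=> /(_ t1); rewrite expr2 -mulrA ler_pM2l// => h.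
  by have := mulr_gt0 tp ap; lra.
have -> : x - z = (x - y) - (z - y) by apply/rowP => i; rewrite !mxE; ring.
rewrite [leRHS]dotpBB -[y - z]opprB dotpNl dotpNr opprK -/a -/b.
have := dotp_ge0 (x - y); lra.
Qed.

End Euclidean.

(** * Sublinear functions and existence of subgradients *)

Lemma le_infD {R : realType} (A B C : set R) :
  has_lbound A -> B !=set0 -> C !=set0 ->
  (forall b c, B b -> C c -> exists2 a, A a & a <= b + c) ->
  inf A <= inf B + inf C.
Proof.
move=> lA B0 C0 h; rewrite -lerBlDr; apply: lb_le_inf => // b Bb.
rewrite lerBlDr -lerBlDl; apply: lb_le_inf => // c Cc.
rewrite lerBlDl; have [a Aa] := h b c Bb Cc; apply: le_trans.
exact: ge_inf.
Qed.

Lemma le_infZ {R : realType} (A B : set R) (t : R) :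
  has_lbound A -> B !=set0 -> 0 <= t ->
  (forall b, B b -> exists2 a, A a & a <= t * b) ->
  inf A <= t * inf B.
Proof.
move=> lA B0; rewrite le0r => /orP[/eqP ->|t0] h.
  have [b Bb] := B0; have [a Aa] := h b Bb; rewrite !mul0r.
  by apply: le_trans; exact: ge_inf.
rewrite -ler_pdivrMl//; apply: lb_le_inf => // b Bb.
rewrite ler_pdivrMl//; have [a Aa] := h b Bb; apply: le_trans.
exact: ge_inf.
Qed.

Section Subgradient.
Context {R : realType} {m : nat}.
Implicit Types (u v w x y z : 'rV[R]_m) (p q : 'rV[R]_m -> R).

(** Homogeneity is only an inequality, which is what infima yield directly; [sublinearZ] recovers
    equality. *)
Definition sublinear p :=
  (forall u v, p (u + v) <= p u + p v) /\
  (forall t u, 0 <= t -> p (t *: u) <= t * p u).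

Lemma sublinear0 p : sublinear p -> p 0 = 0.
Proof.
move=> [pD pZ]; apply/eqP; rewrite eq_le; apply/andP; split.
  by have := pZ 0 0 (lexx 0); rewrite scale0r mul0r.
by have := pD 0 0; rewrite addr0 lerDl.
Qed.

Lemma sublinearZ p t u : sublinear p -> 0 <= t -> p (t *: u) = t * p u.
Proof.
move=> sp; rewrite le0r => /orP[/eqP ->|t0].
  by rewrite scale0r mul0r sublinear0.
have [_ pZ] := sp; apply/eqP; rewrite eq_le pZ ?(ltW t0)//=.
have := pZ t^-1 (t *: u); rewrite invr_ge0 ltW// scalerA mulVf ?gt_eqF//.
by rewrite scale1r [t^-1 * _]mulrC ler_pdivlMr// [_ * t]mulrC; apply.
Qed.

(* q v = inf_(t >= 0) (p (v + t w) - t p w). *)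
Lemma sublinear_linearize p w : sublinear p ->
  exists q, [/\ sublinear q, forall v, q v <= p v & q (- w) <= - p w].
Proof.
move=> sp; have [pD pZ] := sp; have p0 := sublinear0 sp.
pose S v := [set r | exists2 t, 0 <= t & r = p (v + t *: w) - t * p w].
have S0 v : S v !=set0 by exists (p (v + 0 *: w) - 0 * p w); exists 0.
have lS v : has_lbound (S v).
  (* By subadditivity, t p w = p (t w) <= p (v + t w) + p (- v). *)
  exists (- p (- v)) => _ [t t0 ->].
  have := pD (v + t *: w) (- v).
  by rewrite addrAC subrr add0r sublinearZ//; lra.
exists (fun v => inf (S v)); split; first split.
- move=> u v; apply: le_infD => // _ _ [s s0 ->] [t t0 ->].
  exists (p (u + v + (s + t) *: w) - (s + t) * p w).
    by exists (s + t) => //; rewrite addr_ge0.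
  have := pD (u + s *: w) (v + t *: w).
  by rewrite addrACA -scalerDl mulrDl; lra.
- move=> t u t0; apply: le_infZ => // _ [s s0 ->].
  exists (p (t *: u + (t * s) *: w) - (t * s) * p w).
    by exists (t * s) => //; rewrite mulr_ge0.
  rewrite -scalerA -scalerDr mulrBr mulrA lerD2r.
  exact: pZ.
- move=> v; apply: ge_inf => //; exists 0 => //.
  by rewrite scale0r mul0r addr0 subr0.
- apply: ge_inf => //; exists 1 => //.
  by rewrite scale1r mul1r addNr p0 sub0r.
Qed.

(** Linearity along w survives later steps: if q <= p1 <= p and p1 (- w) <= - p w, then q (- w) <= -
    p w <= - q w. *)
Lemma sublinear_linearize_seq p (s : seq 'rV[R]_m) : sublinear p ->
  exists q, [/\ sublinear q, forall v, q v <= p v &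
    forall w, w \in s -> q (- w) <= - q w].
Proof.
elim: s p => [|w s ih] p sp; first by exists p.
have [p1 [sp1 p1p p1w]] := sublinear_linearize w sp.
have [q [sq qp1 qs]] := ih _ sp1.
exists q; split => // [v|v]; first exact: le_trans (qp1 v) (p1p v).
rewrite inE => /orP[/eqP ->|]; last exact: qs.
rewrite (le_trans (qp1 _))// (le_trans p1w)// lerN2.
exact: le_trans (qp1 w) (p1p w).
Qed.

(** A sublinear minorant q of p that is linear along every basis vector is linear, and its values on
    the basis are the coordinates of g. *)
Lemma hahn_banach_rV p : sublinear p -> exists g, forall v, dotp v g <= p v.
Proof.
move=> sp; have [q [sq qp qe]] :=
  sublinear_linearize_seq [seq delta_mx ord0 i | i : 'I_m] sp.
pose g : 'rV[R]_m := \row_i q (delta_mx ord0 i).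
have [qD qZ] := sq; have q0 := sublinear0 sq.
have qc i (c : R) : q (c *: delta_mx ord0 i) <= c * g ord0 i.
  rewrite mxE; have [c0|c0] := leP 0 c; first exact: qZ.
  have := qZ (- c) (- delta_mx ord0 i); rewrite scalerN scaleNr opprK.
  have := qe (delta_mx ord0 i) (map_f _ (mem_enum _ i)).
  by rewrite oppr_ge0 => h /(_ (ltW c0)); nra.
have qg v : q v <= dotp v g.
  rewrite {1}(row_sum_delta v) /dotp.
  elim/big_rec2 : _ => [|i a b _ ab]; first by rewrite q0.
  by rewrite (le_trans (qD _ _))// lerD.
exists g => v; apply: le_trans (qp v).
(* The bound [qg] at - v gives v'g <= - q (- v) <= q v. *)
have := qg (- v); rewrite dotpNl.
have := qD v (- v); rewrite subrr q0; lra.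
Qed.

(* The directional derivative v |-> inf_(t > 0) (f (x + t v) - f x) / t is
   sublinear, and any linear functional below it is a subgradient. *)
Lemma subdiff_nonempty (U : set 'rV[R]_m) (f : 'rV[R]_m -> R) x :
  open U -> convex_set U -> convex_function U f -> U x ->
  subdiff U f x !=set0.
Proof.
move=> Uo cU cf Ux.
have conv (t : R) y z : U y -> U z -> 0 <= t -> t <= 1 ->
    f (t *: y + (1 - t) *: z) <= t * f y + (1 - t) * f z.
  move=> Uy Uz t0 t1.
  by have := cf (Itv01 t0 t1) y z; rewrite !inE => /(_ Uy Uz).
pose S v := [set r | exists t, [/\ 0 < t, U (x + t *: v) &
  r = (f (x + t *: v) - f x) / t]].
have S0 v : exists2 t, 0 < t & U (x + t *: v).
  have : \forall t \near (0 : R), U (x + t *: v).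
    have c : (fun t : R => x + t *: v) @ (0 : R) --> x + (0 : R) *: v.
      by apply: cvgD; [exact: cvg_cst|exact: cvgZr_tmp].
    apply: c; rewrite scale0r addr0; exact: open_nbhs_nbhs.
  move=> /nbhs_ballP[e /= e0 h]; exists (e / 2); first by rewrite divr_gt0.
  by apply: h; rewrite /ball/= sub0r normrN gtr0_norm ?divr_gt0//; lra.
have Sne v : S v !=set0.
  have [t t0 Ut] := S0 v; by exists ((f (x + t *: v) - f x) / t); exists t.
(* For s, t > 0 the point x + st/(s+t) (u + v) is the convex combination of
   x + s u and x + t v with weights t/(s+t) and s/(s+t). *)
have SD u v s t : 0 < s -> 0 < t -> U (x + s *: u) -> U (x + t *: v) ->
    let r := s * t / (s + t) in
    [/\ 0 < r, U (x + r *: (u + v)) & (f (x + r *: (u + v)) - f x) / r <=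
      (f (x + s *: u) - f x) / s + (f (x + t *: v) - f x) / t].
  move=> s0 t0 Us Ut r.
  have st0 : 0 < s + t by rewrite addr_gt0.
  have stn0 : s + t != 0 by rewrite lt0r_neq0.
  have r0 : 0 < r by rewrite divr_gt0 ?mulr_gt0.
  have l0 : 0 <= t / (s + t) by rewrite divr_ge0 ?ltW.
  have l1 : t / (s + t) <= 1 by rewrite ler_pdivrMr// mul1r lerDr ltW.
  have E : x + r *: (u + v) =
      (t / (s + t)) *: (x + s *: u) + (1 - t / (s + t)) *: (x + t *: v).
    by apply/rowP => i; rewrite !mxE /r; field.
  split=> //; first by rewrite E; exact: convex_comb2.
  rewrite ler_pdivrMr// E lerBlDr; apply: le_trans (conv _ _ _ Us Ut l0 l1) _.
  rewrite le_eqVlt; apply/orP; left; apply/eqP; rewrite /r.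
  by field; rewrite stn0 !lt0r_neq0.
(* In [SD] with directions v and - v the combined point is x itself, so the two quotients have a
   nonnegative sum. *)
have lS v : has_lbound (S v).
  have [s s0 Us] := S0 (- v).
  exists (- ((f (x + s *: - v) - f x) / s)) => _ [t [t0 Ut ->]].
  have [_ _] := SD _ _ _ _ t0 s0 Ut Us.
  by rewrite subrr scaler0 addr0 subrr mul0r; lra.
have sp : sublinear (fun v => inf (S v)).
  split=> [u v|t u t0].
    apply: le_infD => // _ _ [s [s0 Us ->]] [t [t0 Ut ->]].
    have [r0 Ur le] := SD _ _ _ _ s0 t0 Us Ut.
    by eexists; [exists (s * t / (s + t)); split => //|].
  apply: le_infZ => // _ [s [s0 Us ->]].
  move: t0; rewrite le0r => /orP[/eqP ->|t0].
    exists 0; last by rewrite mul0r.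
    by exists 1; rewrite !scale0r scaler0 addr0 subrr mul0r; split.
  (* A step s along u is a step s / t along t u. *)
  exists ((f (x + (s / t) *: (t *: u)) - f x) / (s / t)).
    exists (s / t); split=> //; first by rewrite divr_gt0.
    by rewrite scalerA divfK ?lt0r_neq0.
  rewrite scalerA divfK ?lt0r_neq0// le_eqVlt; apply/orP; left; apply/eqP.
  by field; rewrite !lt0r_neq0.
have [g hg] := hahn_banach_rV sp.
exists g; split => // y Uy; apply: le_trans (hg _) _; apply: ge_inf => //.
by exists 1; rewrite scale1r subrKC divr1; split.
Qed.

End Subgradient.

(** * Perron vectors *)

(* Since A 1 = 1, some v <> 0 satisfies v A = v; then w = |v| satisfies
   w <= w A, with equality because both sides have the same sum. *)
Lemma perronP {R : realType} {n : nat} (A : 'M[R]_n) : (0 < n)%N ->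
  row_stochastic A -> strongly_connected (graph_of A) ->
  [/\ forall i, 0 < perron A ord0 i,
      \sum_(i < n) perron A ord0 i = 1 &
      perron A *m A = perron A].
Proof.
move=> n0 [A0 A1] conn.
suff : exists mu : 'rV[R]_n, [/\ forall i, 0 < mu ord0 i,
    \sum_(i < n) mu ord0 i = 1 & mu *m A = mu] by exact: getPex.
have : \det (A - 1%:M) == 0.
  rewrite -det_tr; apply/det0P; exists (const_mx 1).
    apply/eqP => /rowP/(_ (Ordinal n0)); rewrite !mxE => /eqP.
    by rewrite oner_eq0.
  apply/rowP => i; rewrite !mxE.
  under eq_bigr do rewrite !mxE mul1r.
  by rewrite sumrB A1 (bigD1 i)//= eqxx big1 ?addr0 ?subrr// => j ji;
    rewrite eq_sym (negbTE ji).
move=> /det0P[v vn0]; rewrite mulmxBr mulmx1 => /eqP.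
rewrite subr_eq0 => /eqP vA.
pose w i := `|v ord0 i|.
have w0 i : 0 <= w i by exact: normr_ge0.
have wle j : w j <= \sum_i w i * A i j.
  rewrite /w -{1}vA mxE (le_trans (ler_norm_sum _ _ _))// ler_sum// => i _.
  by rewrite normrM (ger0_norm (A0 i j)).
have wA j : \sum_i w i * A i j = w j.
  have : \sum_j (\sum_i w i * A i j - w j) == 0.
    rewrite sumrB exchange_big/= subr_eq0; apply/eqP/eq_bigr => i _.
    by rewrite -mulr_sumr A1 mulr1.
  rewrite psumr_eq0; last by move=> k _; rewrite subr_ge0.
  by move=> /allP/(_ j (mem_index_enum _)) /=; rewrite subr_eq0 => /eqP.
have [i0 wi0] : exists i0, 0 < w i0.
  have /matrix0Pn[i [i0 vi0]] := vn0; exists i0.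
  by rewrite normr_gt0; move: vi0; rewrite ord1.
(* Positivity travels backwards along a path from j to i0: an edge from j to k means A k j > 0, and
   w j >= w k A k j. *)
have wpos j : 0 < w j.
  have /connectP[s] := conn j i0.
  elim: s j => [|k s ih] j /=; first by move=> _ <-.
  move=> /andP[e ps] i0E; have wk := ih _ ps i0E.
  rewrite -wA (bigD1 k)//= ltr_wpDr ?mulr_gt0//.
  by apply: sumr_ge0 => i _; rewrite mulr_ge0.
have S0 : 0 < \sum_i w i.
  by rewrite (bigD1 i0)//= ltr_wpDr// sumr_ge0.
exists (\row_j (w j / \sum_i w i)); split=> [i||].
- by rewrite mxE divr_gt0.
- under eq_bigr do rewrite mxE.
  by rewrite -mulr_suml divff// lt0r_neq0.
- apply/rowP => j; rewrite !mxE -[in RHS]wA mulr_suml.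
  by apply: eq_bigr => i _; rewrite mxE mulrAC.
Qed.

(** * Partial sums of series and limits *)

Lemma nneseries_pinfty_gt {R : realType} (u : nat -> R) (B : R) :
  (forall k, 0 <= u k) -> (\sum_(0 <= k <oo) (u k)%:E = +oo)%E ->
  exists N, B < \sum_(0 <= k < N) u k.
Proof.
move=> u0 uy; apply: contrapT => /forallNP h.
have : (\sum_(0 <= k <oo) (u k)%:E <= B%:E)%E.
  apply: lime_le; first by apply: is_cvg_nneseries => *; rewrite lee_fin.
  apply: nearW => N; rewrite sumEFin lee_fin leNgt; exact/negP/h.
by rewrite uy.
Qed.

Lemma nneseries_lty_le {R : realType} (u : nat -> R) :
  (forall k, 0 <= u k) -> (\sum_(0 <= k <oo) (u k)%:E < +oo)%E ->
  exists B, forall N, \sum_(0 <= k < N) u k <= B.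
Proof.
move=> u0 uy; have s0 : (0 <= \sum_(0 <= k <oo) (u k)%:E)%E.
  by apply: nneseries_ge0 => *; rewrite lee_fin.
exists (fine (\sum_(0 <= k <oo) (u k)%:E)) => N.
rewrite -lee_fin fineK ?ge0_fin_numE// -sumEFin.
by apply: nneseries_lim_ge => *; rewrite lee_fin.
Qed.

(** There are finitely many agents, so one threshold serves all of them. *)
Lemma enorm_cvg0_lt {R : realType} {n m : nat} (x : nat -> 'I_n -> 'rV[R]_m)
    (xbar : 'rV[R]_m) (e : R) :
  (forall i, (fun k => enorm (x k i - xbar)) @ \oo --> (0 : R)) -> 0 < e ->
  exists N, forall k, (N <= k)%N -> forall i, enorm (x k i - xbar) < e.
Proof.
move=> h e0.
have : \forall k \near \oo, forall i, enorm (x k i - xbar) < e.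
  apply: filter_forall => i.
  move/cvgr0Pnorm_lt: (h i) => /(_ e e0); apply: filterS => k.
  by rewrite ger0_norm// enorm_ge0.
by move=> [N _ hN]; exists N => k Nk; exact: hN.
Qed.

Lemma closed_enorm_cvg {R : realType} {m : nat} (X : set 'rV[R]_m)
    (xbar : 'rV[R]_m) : closed X ->
  (forall e, 0 < e -> exists2 x, X x & enorm (x - xbar) < e) -> X xbar.
Proof.
move=> Xc h; apply: Xc => B /nbhs_ballP[e /= e0 eB].
have [x Xx xe] := h e e0; exists x; split=> //; apply: eB.
by rewrite -ball_normE/= distrC (le_lt_trans (norm_le_enorm _)).
Qed.

(** * Runs of the algorithm with a fixed subgradient selection *)

Section Dynamics.
Context {R : realType} {n m : nat}.
Variables (X : set 'rV[R]_m) (U : 'I_n -> set 'rV[R]_m).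
Variables (f : 'I_n -> 'rV[R]_m -> R) (g : 'I_n -> 'rV[R]_m -> 'rV[R]_m).
Variables (L : R) (alpha : nat -> R).
Hypotheses (X_nonempty : X !=set0) (X_closed : closed X).
Hypothesis X_convex : convex_set X.
Hypothesis X_sub_U : forall i, X `<=` U i.
Hypothesis L_gt0 : 0 < L.
Hypothesis gP : forall i x, X x -> subdiff (U i) (f i) x (g i x).
Hypothesis g_le : forall i x, X x -> enorm (g i x) <= L.
Hypothesis alpha_gt0 : forall k, 0 < alpha k.
Hypothesis alpha_sum : (\sum_(0 <= k <oo) (alpha k)%:E = +oo)%E.
Hypothesis alpha2_sum : (\sum_(0 <= k <oo) (alpha k ^+ 2)%:E < +oo)%E.
Implicit Types (M : 'M[R]_n) (x : 'I_n -> 'rV[R]_m) (W : nat -> 'M[R]_n).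

Definition mix M x i : 'rV[R]_m := \sum_(j < n) M i j *: x j.

Definition psg_step M (a : R) x i : 'rV[R]_m :=
  proj X (mix M x i - a *: g i (mix M x i)).

(** With the selection [g] fixed, a run is a function of the weights and the initial states, so runs
    whose weights agree up to a given time coincide until then. *)
Fixpoint psg_traj W x0 k : 'I_n -> 'rV[R]_m :=
  if k is k'.+1 then psg_step (W k') (alpha k') (psg_traj W x0 k') else x0.

Lemma mixX M x i : row_stochastic M -> (forall j, X (x j)) -> X (mix M x i).
Proof. by move=> [M0 M1] Xx; exact: convex_comb. Qed.

Lemma psg_trajX W x0 k i : (forall j, X (x0 j)) -> X (psg_traj W x0 k i).
Proof.
by case: k => //= k _; exact: (projP _ X_nonempty X_closed).1.
Qed.

Lemma eq_psg_traj W W' x0 K :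
  (forall k, (k < K)%N -> W k = W' k) -> psg_traj W x0 K = psg_traj W' x0 K.
Proof.
elim: K => [//|K ih] h /=.
by rewrite (h K (ltnSn K)) ih// => k kK; exact: h (leqW kK).
Qed.

Lemma psg_traj_generated W x0 :
  (forall k, row_stochastic (W k)) -> (forall j, X (x0 j)) ->
  generated X U f alpha W (psg_traj W x0).
Proof.
move=> Wst Xx0; exists (fun k i => g i (mix (W k) (psg_traj W x0 k) i)) => k i.
split=> //; apply: gP; apply: mixX => // j; exact: psg_trajX.
Qed.

Lemma subgradient_lower_bound i (x y : 'rV[R]_m) : X x -> X y ->
  f i x - L * enorm (y - x) <= f i y.
Proof.
move=> Xx Xy; have [_ /(_ y (X_sub_U i Xy))] := gP i Xx.
have := cauchy_schwarz (x - y) (g i x); rewrite -[x - y]opprB dotpNl enormN.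
have := g_le i Xx; have := enorm_ge0 (y - x); nra.
Qed.

(** Used at a limit point x, both for the mixed states of the agents near x and for a single
    minimizer near x. *)
Lemma weighted_lower_bound (mu : 'rV[R]_n) (y : 'I_n -> 'rV[R]_m)
    (x : 'rV[R]_m) (e : R) :
  (forall i, 0 <= mu ord0 i) -> \sum_i mu ord0 i = 1 -> X x ->
  (forall i, X (y i)) -> (forall i, enorm (y i - x) <= e) ->
  \sum_i mu ord0 i * f i x - L * e <= \sum_i mu ord0 i * f i (y i).
Proof.
move=> mu0 mu1 Xx Xy ye.
rewrite -[L * e]mul1r -mu1 mulr_suml -sumrB ler_sum// => i _.
rewrite -mulrBr ler_wpM2l//.
have := subgradient_lower_bound i Xx (Xy i).
by have := ler_wpM2l (ltW L_gt0) (ye i); lra.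
Qed.

(** Projecting does not increase the distance to z. Expanding the square before projection, Jensen
    bounds the mixing term, the subgradient inequality the cross term, and L the last one. *)
Lemma lyapunov_decrease M (mu : 'rV[R]_n) (a : R) x z :
  row_stochastic M -> (forall i, 0 <= mu ord0 i) -> \sum_i mu ord0 i = 1 ->
  mu *m M = mu -> 0 <= a -> (forall i, X (x i)) -> X z ->
  \sum_i mu ord0 i * dotp (psg_step M a x i - z) (psg_step M a x i - z) <=
  \sum_i mu ord0 i * dotp (x i - z) (x i - z)
  - 2 * a * (\sum_i mu ord0 i * f i (mix M x i) - \sum_i mu ord0 i * f i z)
  + a ^+ 2 * L ^+ 2.
Proof.
move=> Mst mu0 mu1 muM a0 Xx Xz; have [M0 M1] := Mst.
have Xv i : X (mix M x i) by exact: mixX.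
(* Invariance of [mu] absorbs the mixing, so that the inequality can be proved agent by agent. *)
have E : \sum_i mu ord0 i * dotp (x i - z) (x i - z) =
    \sum_i mu ord0 i * \sum_j M i j * dotp (x j - z) (x j - z).
  under [RHS]eq_bigr do rewrite mulr_sumr.
  rewrite exchange_big/=; apply: eq_bigr => j _.
  rewrite -{1}muM mxE mulr_suml; apply: eq_bigr => i _.
  by rewrite mulrA.
have -> : a ^+ 2 * L ^+ 2 = \sum_i mu ord0 i * (a ^+ 2 * L ^+ 2).
  by rewrite -mulr_suml mu1 mul1r.
rewrite E -sumrB mulr_sumr -sumrB -big_split/=.
apply: ler_sum => i _; rewrite -mulrBr mulrCA -mulrBr -mulrDr ler_wpM2l//.
apply: le_trans (proj_le _ X_nonempty X_closed X_convex Xz) _.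
rewrite addrAC dotpBB dotpZr dotpZl dotpZr.
have -> : mix M x i - z = \sum_j M i j *: (x j - z).
  under eq_bigr do rewrite scalerBr.
  by rewrite sumrB -scaler_suml M1 scale1r.
have jen := dotp_jensen (fun j => x j - z) (M0 i) (M1 i).
have gL : dotp (g i (mix M x i)) (g i (mix M x i)) <= L ^+ 2.
  by rewrite -sqr_enorm ler_pXn2r ?nnegrE ?enorm_ge0 ?g_le ?ltW.
have [_ /(_ z (X_sub_U i Xz))] := gP i (Xv i).
have -> : z - mix M x i = - \sum_j M i j *: (x j - z).
  under eq_bigr do rewrite scalerBr.
  by rewrite sumrB -scaler_suml M1 scale1r opprB.
rewrite dotpNl; move: jen gL.
set p := dotp (\sum_j _) (\sum_j _); set r := dotp (g i _) (g i _).
set q := dotp _ (g i _); set s := \sum_j _.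
move=> jen gL sub.
have h1 := ler_wpM2l a0 sub.
have h2 := ler_wpM2l (sqr_ge0 a) gL.
lra.
Qed.

(* If z in X did better than xbar by 2 delta, the weighted squared distance to
   z would eventually drop by 2 delta alpha_k - O(alpha_k^2) at each step. *)
Lemma psg_limit_argmin M (mu : 'rV[R]_n) (x : nat -> 'I_n -> 'rV[R]_m)
    (N0 : nat) xbar :
  (0 < n)%N ->
  row_stochastic M -> (forall i, 0 <= mu ord0 i) -> \sum_i mu ord0 i = 1 ->
  mu *m M = mu -> (forall k i, X (x k i)) ->
  (forall k, (N0 <= k)%N -> x k.+1 = psg_step M (alpha k) (x k)) ->
  (forall i, (fun k => enorm (x k i - xbar)) @ \oo --> (0 : R)) ->
  weighted_argmin X f mu xbar.
Proof.
move=> n0 Mst mu0 mu1 muM Xx xS xcvg; have [M0 M1] := Mst.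
have Xb : X xbar.
  apply: closed_enorm_cvg => // e e0; have [N hN] := enorm_cvg0_lt xcvg e0.
  by exists (x N (Ordinal n0)) => //; exact: hN.
split=> // z Xz; rewrite leNgt; apply/negP => zlt.
set Fz := \sum_i _ in zlt; set Fb := \sum_i _ in zlt.
pose delta := (Fb - Fz) / 2; have d0 : 0 < delta by rewrite divr_gt0// subr_gt0.
(* Within delta / L of xbar the weighted objective is at least Fb - delta = Fz + delta. *)
have [N1 hN1] := enorm_cvg0_lt xcvg (divr_gt0 d0 L_gt0).
pose N := maxn N0 N1.
pose V k := \sum_i mu ord0 i * dotp (x k i - z) (x k i - z).
have V0 k : 0 <= V k.
  by apply: sumr_ge0 => i _; rewrite mulr_ge0// dotp_ge0.
have dec k : (N <= k)%N ->
    V k.+1 + 2 * delta * alpha k <= V k + alpha k ^+ 2 * L ^+ 2.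
  rewrite geq_max => /andP[N0k N1k].
  have := @lyapunov_decrease M mu (alpha k) (x k) z Mst mu0 mu1 muM
    (ltW (alpha_gt0 k)) (Xx k) Xz.
  rewrite -xS// -/(V k) -/(V k.+1) -/Fz.
  have := @weighted_lower_bound mu (mix M (x k)) xbar (delta / L) mu0 mu1 Xb.
  rewrite -/Fb [L * _]mulrC divfK ?lt0r_neq0//.
  have hv i : enorm (mix M (x k) i - xbar) <= delta / L.
    have -> : mix M (x k) i - xbar = \sum_j M i j *: (x k j - xbar).
      under eq_bigr do rewrite scalerBr.
      by rewrite sumrB -scaler_suml M1 scale1r.
    apply: le_trans (enorm_sum _) _; rewrite -[leRHS]mul1r -(M1 i) mulr_suml.
    by apply: ler_sum => j _; rewrite enormZ ger0_norm// ler_wpM2l// ltW// hN1.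
  move=> /(_ (fun i => mixX i Mst (Xx k)) hv).
  have := alpha_gt0 k; rewrite /delta; nra.
have [B hB] : exists B, forall K, \sum_(0 <= k < K) alpha k ^+ 2 <= B.
  by apply: nneseries_lty_le => // k; exact: sqr_ge0.
pose S K := \sum_(0 <= k < K) alpha k.
have tel K : (N <= K)%N -> V K + 2 * delta * (S K - S N) <=
    V N + L ^+ 2 *
      (\sum_(0 <= k < K) alpha k ^+ 2 - \sum_(0 <= k < N) alpha k ^+ 2).
  elim: K => [|K ih]; first by rewrite leqn0 => /eqP ->; rewrite !subrr; lra.
  rewrite leq_eqVlt => /orP[/eqP ->|NK]; first by rewrite !subrr; lra.
  have := ih NK; have := dec K NK; rewrite /S !(big_nat_recr K)//=; lra.
(* By this time the accumulated decrease since N exceeds V N + L^2 B, which would make V K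
   negative. *)
have [K hK] := nneseries_pinfty_gt (S N + (V N + L ^+ 2 * B) / (2 * delta))
  (fun k => ltW (alpha_gt0 k)) alpha_sum.
have B0 : 0 <= B by have := hB 0%N; rewrite big_nil.
have S2 : 0 <= \sum_(0 <= k < N) alpha k ^+ 2.
  by apply: sumr_ge0 => k _; exact: sqr_ge0.
have L2 : 0 <= L ^+ 2 by exact: sqr_ge0.
have dd : 0 < 2 * delta by exact: mulr_gt0.
have q0 : 0 <= (V N + L ^+ 2 * B) / (2 * delta).
  apply: divr_ge0; last exact: ltW.
  by apply: addr_ge0 => //; exact: mulr_ge0.
have [NK|KN] := leqP N K; last first.
  have : S K <= S N.
    rewrite /S (big_cat_nat (leq0n K) (ltnW KN))/= lerDl.
    by apply: sumr_ge0 => k _; exact: ltW.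
  by rewrite -/(S K) in hK; lra.
have := tel K NK; have := V0 K; have := hB K.
move: hK; rewrite -/(S K) addrC -ltrBrDr ltr_pdivrMr//.
set s2 := \sum_(0 <= k < K) alpha k ^+ 2.
move=> h1 h2 h3 h4.
have := ler_wpM2l L2 h2; have := mulr_ge0 L2 S2; lra.
Qed.

End Dynamics.

(** * The switching construction *)

Theorem theorem1 (R : realType) (n m p : nat) (n_gt0 : (0 < n)%N)
  (X : set 'rV[R]_m)
  (X_nonempty : X !=set0) (X_closed : closed X) (X_convex : convex_set X)
  (U : 'I_n -> set 'rV[R]_m)
  (U_open : forall i, open (U i)) (U_convex : forall i, convex_set (U i))
  (X_sub_U : forall i, X `<=` U i)
  (f : 'I_n -> 'rV[R]_m -> R)
  (f_convex : forall i, convex_function (U i) (f i))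
  (L : R) (L_gt0 : 0 < L)
  (subgrad_bounded : forall i x d,
    X x -> subdiff (U i) (f i) x d -> enorm d <= L)
  (alpha : nat -> R) (alpha_gt0 : forall k, 0 < alpha k)
  (alpha_sum : (\sum_(0 <= k <oo) (alpha k)%:E = +oo)%E)
  (alpha2_sum : (\sum_(0 <= k <oo) (alpha k ^+ 2)%:E < +oo)%E)
  (A : 'I_p -> 'M[R]_n)
  (A_stochastic : forall l, row_stochastic (A l))
  (A_connected : forall l, strongly_connected (graph_of (A l)))
  (eta : R) (eta_gt0 : 0 < eta) (eta_lt1 : eta < 1)
  (A_pos_ge : forall l i j, 0 < A l i j -> eta <= A l i j)
  (A_diag_ge : forall l i, eta <= A l i i)
  (no_common_min :
    \bigcap_(l in [set: 'I_p]) weighted_argmin X f (perron (A l)) = set0) :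
  exists W : nat -> 'M[R]_n,
    (forall k, exists l, W k = A l) /\ ~ convergent X U f alpha W.
Proof.
have perrP l := perronP n_gt0 (A_stochastic l) (A_connected l).
have [x0 Xx0] := X_nonempty.
pose g i x := get (subdiff (U i) (f i) x).
have gP i x : X x -> subdiff (U i) (f i) x (g i x).
  by move=> Xx; apply: getPex; apply: subdiff_nonempty => //; exact: X_sub_U.
have g_le i x : X x -> enorm (g i x) <= L.
  by move=> Xx; exact: subgrad_bounded Xx (gP i x Xx).
(* For p = 0 the intersection would be the whole space, which contains x0. *)
have p_gt0 : (0 < p)%N.
  rewrite lt0n; apply/eqP => p0; suff : set0 x0 by [].
  by rewrite -no_common_min => l; have := ltn_ord l; rewrite {2}p0.
apply: contrapT => /forallNP H.
have conv (idx : nat -> 'I_p) : convergent X U f alpha (fun k => A (idx k)).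
  apply: contrapT => nc; apply: (H (fun k => A (idx k))).
  by split=> // k; exists (idx k).
pose traj (idx : nat -> 'I_p) :=
  psg_traj X g alpha (fun k => A (idx k)) (fun=> x0).
have trajX idx k i : X (traj idx k i) by exact: psg_trajX.
have traj_conv idx : exists xbar, forall i,
    (fun k => enorm (traj idx k i - xbar)) @ \oo --> (0 : R).
  by apply: (conv idx); exact: psg_traj_generated.
pose switch (idx : nat -> 'I_p) K l k := if (k < K)%N then idx k else l.
(* If A_l is kept forever after time K, the run converges to a minimizer for A_l, so a finite time T
   already brings all agents within e of it. *)
have phase idx K l e : 0 < e -> exists T, (K < T)%N /\
    exists2 y, weighted_argmin X f (perron (A l)) y &
    forall i, enorm (traj (switch idx K l) T i - y) < e.
  move=> e0; have [xbar xc] := traj_conv (switch idx K l).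
  have [N hN] := enorm_cvg0_lt xc e0.
  exists (maxn K.+1 N); split; first by rewrite leq_maxl.
  exists xbar; last by move=> i; apply: hN; rewrite leq_maxr.
  have [mu0 mu1 muA] := perrP l.
  have step k : (K <= k)%N -> traj (switch idx K l) k.+1 =
      psg_step X g (A l) (alpha k) (traj (switch idx K l) k).
    by move=> Kk; rewrite /traj/= /switch ltnNge Kk.
  exact: (psg_limit_argmin X_nonempty X_closed X_convex X_sub_U L_gt0 gP g_le
    alpha_gt0 alpha_sum alpha2_sum n_gt0 (A_stochastic l)
    (fun i => ltW (mu0 i)) mu1 muA (trajX _) step xc).
have inv_gt0 r : 0 < r.+1%:R^-1 :> R by rewrite invr_gt0 ltr0n.
pose next idx K l r := sval (cid (phase idx K l _ (inv_gt0 r))).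
have nextP idx K l r : (K < next idx K l r)%N /\
    exists2 y, weighted_argmin X f (perron (A l)) y &
    forall i, enorm (traj (switch idx K l) (next idx K l r) i - y) < r.+1%:R^-1.
  exact: svalP (cid (phase idx K l _ (inv_gt0 r))).
pose lab r : 'I_p := Ordinal (ltn_pmod r p_gt0).
(* After r phases: an index sequence, final only before the recorded time, and that time. The
   initial sequence [lab] is a placeholder, since the initial time is 0. *)
pose st r := iteri r
  (fun r s => (switch s.1 s.2 (lab r), next s.1 s.2 (lab r) r)) (lab, 0%N).
have st_lt r : ((st r).2 < (st r.+1).2)%N.
  by have [] := nextP (st r).1 (st r).2 (lab r) r.
have st_ge r : (r <= (st r).2)%N.
  by elim: r => // r ih; exact: leq_ltn_trans ih (st_lt r).
have st_agree r d k : (k < (st r).2)%N ->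
    (k < (st (r + d)).2)%N /\ (st (r + d)%N).1 k = (st r).1 k.
  move=> kr; elim: d => [|d [ih1 ih2]]; first by rewrite addn0.
  rewrite addnS; split; first exact: ltn_trans ih1 (st_lt _).
  rewrite -ih2 -[LHS]/(switch (st (r + d)%N).1 (st (r + d)%N).2 _ k).
  by rewrite /switch ih1.
(* Each phase lasts at least one step, so entry k is final after k + 1 phases. *)
pose idx k := (st k.+1).1 k.
have idxE r k : (k < (st r).2)%N -> idx k = (st r).1 k.
  move=> kr; rewrite /idx; have [rk|/ltnW kr'] := leqP r k.+1.
    by rewrite -(subnKC rk); have [] := st_agree r (k.+1 - r)%N k kr.
  rewrite -(subnKC kr').
  by have [] := st_agree k.+1 (r - k.+1)%N k (st_ge k.+1).
have idx_near r : exists2 y, weighted_argmin X f (perron (A (lab r))) y &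
    forall i, enorm (traj idx (st r.+1).2 i - y) < r.+1%:R^-1.
  have [_ [y ymin hy]] := nextP (st r).1 (st r).2 (lab r) r.
  exists y => // i; apply: le_lt_trans (hy i).
  (* The state at the end of phase r depends only on weights that are already final. *)
  rewrite /traj (@eq_psg_traj _ _ _ X g alpha _ (fun k => A ((st r.+1).1 k)))//.
  by move=> k kr; rewrite (idxE r.+1).
have [xbar xc] := traj_conv idx.
have Xb : X xbar.
  apply: closed_enorm_cvg => // e e0; have [N hN] := enorm_cvg0_lt xc e0.
  by exists (traj idx N (Ordinal n_gt0)) => //; exact: hN.
suff : set0 xbar by [].
rewrite -no_common_min => l _; split=> // z Xz; have [mu0 mu1 _] := perrP l.
rewrite leNgt; apply/negP => zlt.
set Fz := \sum_i _ in zlt; set Fb := \sum_i _ in zlt.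
(* L e is half the gap, so a point of X within e of xbar still has objective above Fz and cannot be
   a minimizer. *)
pose e := (Fb - Fz) / 2 / L.
have e0 : 0 < e by rewrite !divr_gt0// subr_gt0.
have e20 : 0 < e / 2 by rewrite divr_gt0.
have [N hN] := enorm_cvg0_lt xc e20.
(* Phase r = s p + l uses A_l, ends after time N, and has accuracy 1 / (r + 1) < e / 2. *)
pose s := maxn N (Num.truncn (e / 2)^-1).
pose r := (s * p + l)%N.
have sr : (s <= r)%N by rewrite (leq_trans (leq_pmulr s p_gt0))// leq_addr.
have labr : lab r = l by apply/val_inj; rewrite /= modnMDl modn_small.
have re : r.+1%:R^-1 < e / 2.
  rewrite invf_plt ?posrE ?ltr0n//; apply: lt_le_trans (truncnS_gt _) _.
  by rewrite ler_nat ltnS (leq_trans _ sr)// leq_maxr.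
have [y [Xy ymin] hy] := idx_near r; rewrite labr in ymin.
have xK : forall i, enorm (traj idx (st r.+1).2 i - xbar) < e / 2.
  apply: hN; apply: leq_trans (leq_trans _ (leqnSn r)) (st_ge r.+1).
  by rewrite (leq_trans _ sr)// leq_maxl.
have yx : enorm (y - xbar) <= e.
  have := lt_trans (hy (Ordinal n_gt0)) re; have := xK (Ordinal n_gt0).
  set x := traj _ _ _ => h1 h2.
  have -> : y - xbar = (y - x) + (x - xbar) by rewrite addrA subrK.
  have := enormD (y - x) (x - xbar); rewrite [enorm (y - x)]enormBC; lra.
have := weighted_lower_bound X_sub_U L_gt0 gP g_le (fun i => ltW (mu0 i)) mu1
  Xb (fun=> Xy) (fun=> yx).
have := ymin z Xz; rewrite -/Fb -/Fz /e [L * _]mulrC divfK ?lt0r_neq0//.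
move: zlt; lra.
Qed.
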